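(* Let $r\ge 1$, $k\ge 1$ and $(e_1,\dots,e_r)\in\mathbf{Z}^r$. The number of cyclically reduced words of length $k$ in the free group $F_r=\langle a_1,\dots,a_r\rangle$ whose class in the abelianization $\mathbf{Z}^r$ is $e_1[a_1]+\cdots+e_r[a_r]$ is equal to the coefficient of $x_1^{e_1}\cdots x_r^{e_r}$ in the Laurent polynomial $$2\left(\sqrt{2r-1}\right)^k R_k\!\left(\frac{r}{\sqrt{2r-1}};x_1,\dots,x_r\right)+(r-1)\left[1+(-1)^k\right].$$
   Context: A word in the letters $a_1,\dots,a_r,a_1^{-1},\dots,a_r^{-1}$ is cyclically reduced if no letter is adjacent to its inverse, where the last letter and the first letter of the word are also regarded as adjacent. The abelianization of $F_r$ is $\mathbf{Z}^r$ with basis $[a_1],\dots,[a_r]$; the class of a word is $e_1[a_1]+\cdots+e_r[a_r]$, where $e_i$ is the total exponent of $a_i$ in the word. $T_n$ denotes the Chebyshev polynomial of the first kind: $T_0(x)=1$, $T_1(x)=x$, $T_{n+1}(x)=2xT_n(x)-T_{n-1}(x)$. The Laurent polynomial $R_n$ is defined by $$R_n(c;x_1,\dots,x_m)=T_n\left(\frac{c}{2m}\sum_{i=1}^m\left(x_i+\frac1{x_i}\right)\right).$$ *)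

(* Defs.v *)
(* Mathematical Components, with the formal sums [{malg R[K]}] of multinomials. *)
From HB Require Import structures.
From mathcomp Require Import all_boot all_order all_algebra finmap.
From mathcomp.multinomials Require Import monalg.
Set Implicit Arguments.
Unset Strict Implicit.
Unset Printing Implicit Defensive.
Import Order.TTheory GRing.Theory Num.Theory.
Local Open Scope fset_scope.
Local Open Scope ring_scope.

(* [(i, false)] is the letter a_i and [(i, true)] is its inverse. *)
Notation letter r := ('I_r * bool)%type.

Definition inv_letter (r : nat) (x : letter r) : letter r := (x.1, ~~ x.2).

(* [cycle] also relates the last letter to the first one. *)
Definition cyclically_reduced (r : nat) (w : seq (letter r)) : bool :=
  cycle [rel x y | y != inv_letter x] w.

(* Z^r is [{ffun 'I_r -> int}]; coordinate [i] is the total exponent of a_i. *)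
Definition word_class (r : nat) (w : seq (letter r)) : {ffun 'I_r -> int} :=
  [ffun i => \sum_(x <- w | x.1 == i) (-1) ^+ x.2].

(* Laurent polynomials in r variables are the group algebra R[Z^r].  The ring  *)
(* structure that monalg puts on [{malg R[K]}] needs a monoid [K] without      *)
(* nontrivial invertible elements, so the convolution product is built here.   *)
Definition laurent (R : comNzRingType) (r : nat) : Type :=
  {malg R[{ffun 'I_r -> int}]}.

Definition lmonom (R : comNzRingType) (r : nat) (u : {ffun 'I_r -> int}) :
  laurent R r := mkmalgU u 1.

Definition lcoeff (R : comNzRingType) (r : nat) (u : {ffun 'I_r -> int})
  (p : laurent R r) : R := mcoeff u p.

Section LaurentRing.
Variables (R : comNzRingType) (r : nat).
Local Notation L := (laurent R r).
Implicit Types (p q : L) (u v : {ffun 'I_r -> int}).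

HB.instance Definition _ := GRing.Lmodule.on L.

Definition laurent_mul p q : L :=
  \sum_(u <- msupp p) \sum_(v <- msupp q)
    mkmalgU (u + v) (mcoeff u p * mcoeff v q).

Lemma laurent_mulw (d1 d2 : {fset {ffun 'I_r -> int}}) p q :
  msupp p `<=` d1 -> msupp q `<=` d2 ->
  laurent_mul p q =
  \sum_(u <- d1) \sum_(v <- d2) mkmalgU (u + v) (mcoeff u p * mcoeff v q).
Proof.
move=> le_d1 le_d2; rewrite /laurent_mul (big_fset_incl _ le_d1) /=.
  apply/eq_bigr=> u _; apply/big_fset_incl => // v _ /mcoeff_outdom ->.
  by rewrite mulr0 monalgU0.
move=> u _ /mcoeff_outdom pu.
by rewrite big1 => // v _; rewrite pu mul0r monalgU0.
Qed.

Lemma laurent_mulC : commutative laurent_mul.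
Proof.
move=> p q; rewrite /laurent_mul exchange_big; apply: eq_bigr => u _.
by apply: eq_bigr => v _; rewrite addrC mulrC.
Qed.

Lemma laurent_mul0 q : laurent_mul 0 q = 0.
Proof. by rewrite /laurent_mul msupp0 big_seq_fset0. Qed.

Lemma laurent_mulDl : left_distributive laurent_mul +%R.
Proof.
move=> p1 p2 q.
rewrite (laurent_mulw (msuppD_le p1 p2) (fsubset_refl (msupp q))).
rewrite (laurent_mulw (fsubsetUl (msupp p1) (msupp p2)) (fsubset_refl (msupp q))).
rewrite (laurent_mulw (fsubsetUr (msupp p1) (msupp p2)) (fsubset_refl (msupp q))).
rewrite -big_split /=; apply/eq_bigr=> u _.
rewrite -big_split /=; apply/eq_bigr=> v _.
by rewrite mcoeffD mulrDl monalgUD.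
Qed.

Lemma laurent_mulDr : right_distributive laurent_mul +%R.
Proof. by move=> p q1 q2; rewrite !(laurent_mulC p) laurent_mulDl. Qed.

Lemma laurent_mulUU (c d : R) u v :
  laurent_mul (mkmalgU u c) (mkmalgU v d) = mkmalgU (u + v) (c * d).
Proof.
by rewrite (laurent_mulw msuppU_le msuppU_le) !big_seq_fset1 !mcoeffUU.
Qed.

Lemma laurent_ind (P : L -> Prop) :
  P 0 -> (forall p q, P p -> P q -> P (p + q)) ->
  (forall u c, P (mkmalgU u c)) -> forall p, P p.
Proof.
by move=> P0 PD PU p; rewrite [p]monalgE; apply: big_ind => // u _; apply: PU.
Qed.

Lemma laurent_mulA : associative laurent_mul.
Proof.
move=> p q s; have mul0r' x : laurent_mul x 0 = 0.
  by rewrite laurent_mulC laurent_mul0.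
elim/laurent_ind: p => [|p p' IHp IHp'|u c]; first by rewrite !laurent_mul0.
  by rewrite !laurent_mulDl IHp IHp'.
elim/laurent_ind: q => [|q q' IHq IHq'|v d].
- by rewrite laurent_mul0 !mul0r' laurent_mul0.
- by rewrite laurent_mulDl !laurent_mulDr laurent_mulDl IHq IHq'.
elim/laurent_ind: s => [|s s' IHs IHs'|w b]; first by rewrite !mul0r'.
  by rewrite !laurent_mulDr IHs IHs'.
by rewrite !laurent_mulUU mulrA addrA.
Qed.

Lemma laurent_mul1 : left_id (lmonom R 0) laurent_mul.
Proof.
elim/laurent_ind => [|p q IHp IHq|u c].
- by rewrite laurent_mulC laurent_mul0.
- by rewrite laurent_mulDr IHp IHq.
by rewrite laurent_mulUU mul1r add0r.
Qed.

Lemma laurent_1_neq0 : lmonom R 0 != 0 :> L.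
Proof. by rewrite monalgU_eq0 oner_eq0. Qed.

HB.instance Definition _ := GRing.Zmodule_isComNzRing.Build L
  laurent_mulA laurent_mulC laurent_mul1 laurent_mulDl laurent_1_neq0.

Lemma laurent_scaleAl (c : R) p q : c *: (p * q) = (c *: p) * q.
Proof.
have scaleU (d : R) u : c *: (mkmalgU u d : L) = mkmalgU u (c * d).
  by apply/malgP => v; rewrite mcoeffZ !mcoeffU mulrnAr.
elim/laurent_ind: p => [|p p' IHp IHp'|u d].
- by rewrite scaler0 !mul0r scaler0.
- by rewrite scalerDr !mulrDl scalerDr IHp IHp'.
elim/laurent_ind: q => [|q q' IHq IHq'|v b].
- by rewrite !mulr0 scaler0.
- by rewrite !mulrDr scalerDr IHq IHq'.
by rewrite /GRing.mul /= scaleU !laurent_mulUU scaleU mulrA.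
Qed.

HB.instance Definition _ := GRing.Lmodule_isLalgebra.Build R L laurent_scaleAl.
HB.instance Definition _ := GRing.Lalgebra_isComAlgebra.Build R L.

Lemma lmonom0 : lmonom R 0 = 1 :> L.
Proof. by []. Qed.

Lemma lmonomD u v : lmonom R (u + v) = lmonom R u * lmonom R v :> L.
Proof. by rewrite [RHS]laurent_mulUU mulr1. Qed.

Lemma lcoeff_lmonom u v : lcoeff u (lmonom R v) = (v == u)%:R.
Proof. exact: mcoeffU. Qed.

End LaurentRing.

Definition basis_vec (r : nat) (i : 'I_r) : {ffun 'I_r -> int} :=
  [ffun j => (i == j)%:R].

(* The variable x_i and its inverse 1/x_i. *)
Definition lvar (R : comNzRingType) (r : nat) (i : 'I_r) : laurent R r :=
  lmonom R (basis_vec i).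
Definition lvarV (R : comNzRingType) (r : nat) (i : 'I_r) : laurent R r :=
  lmonom R (- basis_vec i).

Lemma lvarK (R : comNzRingType) (r : nat) (i : 'I_r) :
  lvar R i * lvarV R i = 1.
Proof. by rewrite -lmonomD subrr. Qed.

Fixpoint chebyshevT (R : nzRingType) (n : nat) : {poly R} :=
  match n with
  | 0 => 1
  | n'.+1 => match n' with
             | 0 => 'X
             | n''.+1 => 2 *: 'X * chebyshevT R n' - chebyshevT R n''
             end
  end.

(* R_n(c; x_1, ..., x_m) *)
Definition chebyshevR (F : fieldType) (m n : nat) (c : F) : laurent F m :=
  horner_alg ((c / (2 * m%:R)) *: \sum_(i < m) (lvar F i + lvarV F i))
             (chebyshevT F n).

(* Main.v *)
(* The generating function of cyclically reduced words is the trace of [A ^ k],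
   where [A] is the weighted non-backtracking operator on functions of letters.
   [A] is a rank one operator minus a weighted involution, so [A ^ 2 - 1] has
   rank two, with image in a space on which [A ^ 2 - S A + q] vanishes, where
   [S] is the sum of all letters and [q + 1] their number.  Hence the traces
   obey the linear recurrence with characteristic polynomial
   [(t ^ 2 - 1) (t ^ 2 - S t + q)], and the right-hand side obeys it as well. *)
Require Import Defs.
From mathcomp Require Import all_boot all_order all_algebra ring.
From mathcomp.multinomials Require Import monalg.
Import Order.TTheory GRing.Theory Num.Theory.
Local Open Scope ring_scope.

(** * Traces of the non-backtracking operator over a finite alphabet *)

Section NonBacktracking.
Variables (K : comNzRingType) (T : finType) (X : T -> K) (inv : T -> T).

Definition nonbacktracking (f : T -> K) (x : T) : K :=
  \sum_(y | y != inv x) X y * f y.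
Local Notation A := nonbacktracking.

Definition nbtrace (k : nat) : K := \sum_x iter k A (fun y => (y == x)%:R) x.

(** Each application of [A] prepends one weighted step to the path. The starting letter [x] carries
    no weight. *)
Lemma iter_nonbacktracking (k : nat) (f : T -> K) (x : T) :
  iter k A f x =
  \sum_(w : k.-tuple T | path [rel x y | y != inv x] x w)
     (\prod_(y <- w) X y) * f (last x w).
Proof.
elim: k x => [|k IHk] x.
  rewrite (big_pred1 [tuple]) => [|w]; first by rewrite big_nil mul1r.
  by rewrite [w]tuple0 /= eqxx.
rewrite iterS /nonbacktracking (reindex (fun p : T * k.-tuple T => cons_tuple p.1 p.2)) /=; last first.
  exists (fun w : k.+1.-tuple T => (thead w, behead_tuple w)) => [[y w] _|w _].
    by congr pair; apply: val_inj.
  by rewrite [RHS]tuple_eta; apply: val_inj.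
rewrite -(pair_big_dep (fun y => y != inv x)
  (fun y (w : k.-tuple T) => path [rel x y | y != inv x] y w)
  (fun y (w : k.-tuple T) => (\prod_(z <- y :: w) X z) * f (last y w))) /=.
apply: eq_bigr => y _; rewrite IHk mulr_sumr; apply: eq_bigr => w _.
by rewrite big_cons mulrA.
Qed.

(** Taken at the indicator of [x], the path expansion keeps the paths that return to [x], and these
    are the cyclic words ending in [x]. Length 0 is excluded: there the left side would be 1 and the
    trace [#|T|]. *)
Lemma cycle_sum (k : nat) :
  \sum_(w : k.+1.-tuple T | cycle [rel x y | y != inv x] w) \prod_(y <- w) X y
  = nbtrace k.+1.
Proof.
rewrite /nbtrace; under [RHS]eq_bigr => x _ do
  rewrite iter_nonbacktracking big_mkcond.
rewrite exchange_big big_mkcond; apply: eq_bigr => w _ /=.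
(* Only the starting point equal to the last letter of [w] contributes; as [w] is nonempty, the
   default [thead w] is harmless. *)
rewrite (bigD1 (last (thead w) w)) //= [X in _ = _ + X]big1 ?addr0 => [|x].
  rewrite -(cycle_path (thead w)); case: ifP => // _.
  by case/tupleP: w => y w /=; rewrite eqxx mulr1.
case/tupleP: w => y w /= neq_x.
by rewrite [last y w == x]eq_sym (negPf neq_x) mulr0 if_same.
Qed.

Hypothesis invK : involutive inv.
Hypothesis XV : forall x, X x * X (inv x) = 1.

Let S := \sum_x X x.
Let dot (f : T -> K) := \sum_x X x * f x.
Let tot (f : T -> K) := \sum_x f x.

Lemma nonbacktrackingE (f : T -> K) (x : T) :
  A f x = dot f - X (inv x) * f (inv x).
Proof. by rewrite /dot (bigD1 (inv x)) //= addrC addrK. Qed.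

(** By [XV] the weights cancel in the involution term. With [tot_nonbacktracking], [A] acts on the
    pair ([dot], [tot]) by a 2 by 2 matrix with characteristic polynomial [t ^ 2 - S t + q], where
    [q = #|T| - 1]. *)
Lemma dot_nonbacktracking (f : T -> K) : dot (A f) = S * dot f - tot f.
Proof.
rewrite {1}/dot; under eq_bigr => x _ do
  rewrite nonbacktrackingE mulrBr mulrA XV mul1r.
rewrite big_split /= -mulr_suml sumrN; congr (_ - _).
by rewrite [RHS](reindex_inj (can_inj invK)).
Qed.

Lemma tot_nonbacktracking (f : T -> K) : tot (A f) = (#|T|%:R - 1) * dot f.
Proof.
rewrite {1}/tot; under eq_bigr => x _ do rewrite nonbacktrackingE.
rewrite big_split /= sumrN sumr_const mulrBl mul1r mulr_natl; congr (_ - _).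
by rewrite [RHS](reindex_inj (can_inj invK)).
Qed.

Lemma nonbacktracking2 (f : T -> K) (x : T) :
  A (A f) x = f x + S * dot f - tot f - X (inv x) * dot f.
Proof.
rewrite nonbacktrackingE dot_nonbacktracking (nonbacktrackingE f) invK.
rewrite mulrBr (mulrA (X _)) (mulrC (X (inv x)) (X x)) XV mul1r.
by ring.
Qed.

(** This is [(A ^ 2 - S A + q) (A ^ 2 - 1) = 0] expanded, with [q = #|T| - 1]. *)
Lemma nonbacktracking_rec (f : T -> K) (x : T) :
  A (A (A (A f))) x = S * A (A (A f)) x - (#|T|%:R - 2) * A (A f) x
                      - S * A f x + (#|T|%:R - 1) * f x.
Proof.
rewrite !nonbacktracking2 !(dot_nonbacktracking, tot_nonbacktracking).
by ring.
Qed.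

Lemma nbtrace_rec (k : nat) :
  nbtrace k.+4 = S * nbtrace k.+3 - (#|T|%:R - 2) * nbtrace k.+2
                 - S * nbtrace k.+1 + (#|T|%:R - 1) * nbtrace k.
Proof.
rewrite /nbtrace !mulr_sumr -!sumrB -big_split /=; apply: eq_bigr => x _.
exact: nonbacktracking_rec.
Qed.

Lemma dot_delta (x : T) : dot (fun y => (y == x)%:R) = X x.
Proof.
rewrite /dot (bigD1 x) //= eqxx mulr1 big1 ?addr0 // => y /negPf ->.
exact: mulr0.
Qed.

Lemma tot_delta (x : T) : tot (fun y => (y == x)%:R) = 1.
Proof. by rewrite /tot (bigD1 x) //= eqxx big1 ?addr0 // => y /negPf ->. Qed.

(** The recurrence has order four, so the traces for [k] from 0 to 3 serve as initial values. *)
Lemma nbtrace0 : nbtrace 0 = #|T|%:R.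
Proof.
by rewrite /nbtrace /=; under eq_bigr => x _ do rewrite eqxx; rewrite sumr_const.
Qed.

Hypothesis inv_neq : forall x, inv x != x.

Lemma nonbacktracking_delta (x : T) : A (fun y => (y == x)%:R) x = X x.
Proof. by rewrite nonbacktrackingE dot_delta (negPf (inv_neq x)) mulr0 subr0. Qed.

Lemma nbtrace1 : nbtrace 1 = S.
Proof. by apply: eq_bigr => x _; rewrite /= nonbacktracking_delta. Qed.

Lemma nbtrace2 : nbtrace 2 = S ^+ 2 - #|T|%:R.
Proof.
rewrite /nbtrace /=; under eq_bigr => x _ do
  rewrite nonbacktracking2 dot_delta tot_delta eqxx (mulrC (X (inv x))) XV
    [1 + _]addrC addrK.
by rewrite big_split /= -mulr_sumr sumrN sumr_const expr2.
Qed.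

Lemma nbtrace3 : nbtrace 3 = S ^+ 3 - 3 * (#|T|%:R - 1) * S.
Proof.
have A3 x : iter 3 A (fun y => (y == x)%:R) x =
    (S ^+ 2 - #|T|%:R + 2) * X x + (X (inv x) - 2 * S).
  rewrite /= nonbacktracking2 nonbacktracking_delta.
  rewrite dot_nonbacktracking tot_nonbacktracking dot_delta tot_delta.
  rewrite [X (inv x) * _]mulrBr mulrCA (mulrC (X (inv x)) (X x)) XV.
  by ring.
rewrite /nbtrace (eq_bigr _ (fun x _ => A3 x)) big_split -mulr_sumr /=.
rewrite big_split sumr_const /= -mulr_natl.
have -> : \sum_x X (inv x) = S by rewrite [RHS](reindex_inj (can_inj invK)).
by rewrite -/S; ring.
Qed.

(** [P] is the power sum of the two roots of [t ^ 2 - S t + q], and [1 + (-1) ^ k] that of the roots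
    of [t ^ 2 - 1]. The trace at 0, [2 r = 2 + 2 (r - 1)], fixes the factor [r - 1]. *)
Lemma nbtraceE (r : nat) (P : nat -> K) :
  #|T| = (2 * r)%N -> P 0%N = 2 -> P 1%N = S ->
  (forall k, P k.+2 = S * P k.+1 - (2 * r%:R - 1) * P k) ->
  forall k, nbtrace k = P k + (r%:R - 1) * (1 + (-1) ^+ k).
Proof.
move=> cardT P0 P1 Prec k.
suff: [/\ nbtrace k = P k + (r%:R - 1) * (1 + (-1) ^+ k),
          nbtrace k.+1 = P k.+1 + (r%:R - 1) * (1 + (-1) ^+ k.+1),
          nbtrace k.+2 = P k.+2 + (r%:R - 1) * (1 + (-1) ^+ k.+2)
        & nbtrace k.+3 = P k.+3 + (r%:R - 1) * (1 + (-1) ^+ k.+3)] by case.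
elim: k => [|k [IH0 IH1 IH2 IH3]].
  rewrite nbtrace0 nbtrace1 nbtrace2 nbtrace3 !Prec P0 P1 cardT natrM.
  by split; ring.
split=> //; rewrite nbtrace_rec IH0 IH1 IH2 IH3 !Prec cardT natrM !exprS.
by ring.
Qed.

End NonBacktracking.

(** * Letters as Laurent monomials, and the Chebyshev side *)

Lemma inv_letterK (r : nat) : involutive (@inv_letter r).
Proof. by case=> i b; rewrite /inv_letter /= negbK. Qed.

Lemma inv_letter_neq (r : nat) (x : letter r) : inv_letter x != x.
Proof. by case: x => i []; rewrite /inv_letter xpair_eqE /= andbF. Qed.

Definition lletter (R : comNzRingType) {r : nat} (x : letter r) : laurent R r :=
  if x.2 then lvarV R x.1 else lvar R x.1.

Lemma lletterV (R : comNzRingType) (r : nat) (x : letter r) :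
  lletter R x * lletter R (inv_letter x) = 1.
Proof. by case: x => i []; rewrite /lletter /= ?lvarK // mulrC lvarK. Qed.

Lemma sum_lletter (R : comNzRingType) (r : nat) :
  \sum_x lletter R x = \sum_(i < r) (lvar R i + lvarV R i).
Proof.
rewrite -(pair_bigA _ (fun i b => lletter R (i, b))) /=.
by apply: eq_bigr => i _; rewrite big_bool addrC.
Qed.

Lemma prod_lletter (R : comNzRingType) (r : nat) (w : seq (letter r)) :
  \prod_(x <- w) lletter R x = lmonom R (word_class w).
Proof.
elim: w => [|x w IHw].
  rewrite big_nil -lmonom0; congr lmonom.
  by apply/ffunP => i; rewrite !ffunE big_nil.
rewrite big_cons IHw.
have -> : lletter R x = lmonom R (if x.2 then - basis_vec x.1 else basis_vec x.1).
  by case: x => i [].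
rewrite -lmonomD; congr lmonom; apply/ffunP => i.
rewrite !ffunE big_cons; case: x => j b /=.
by case: b; rewrite !ffunE; case: (j == i); rewrite ?oppr0 ?add0r.
Qed.

(** With [c = r / s] the Chebyshev argument is [S / (2 s)], so the factor [s ^ k] turns the
    Chebyshev recurrence into one with coefficients [S] and [s ^ 2]. *)
Lemma chebyshevR_rec (F : fieldType) (r k : nat) (s : F) :
  let P j := (2 * s ^+ j) *: chebyshevR r j (r%:R / s) : laurent F r in
  (2 : F) != 0 -> r%:R != 0 :> F -> s != 0 ->
  [/\ P 0%N = 2, P 1%N = \sum_x lletter F x
    & P k.+2 = (\sum_x lletter F x) * P k.+1 - (s ^+ 2)%:A * P k].
Proof.
move=> P two_neq0 r_neq0 s_neq0.
have cE : r%:R / s / (2 * r%:R) = (2 * s)^-1 :> F.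
  by field; rewrite s_neq0 two_neq0.
rewrite /P /chebyshevR cE -sum_lletter; set S := \sum_x _.
split=> /=.
- by rewrite rmorph1 expr0 mulr1 scaler_nat.
- by rewrite horner_algX scalerA expr1 divff ?scale1r // mulf_neq0.
rewrite rmorphB rmorphM /= linearZ /= horner_algX.
set T1 := horner_alg _ (chebyshevT F k.+1); set T0 := horner_alg _ _.
rewrite scalerBr -!scalerAl mul1r -!scalerAr !scalerA !mul1r -scalerAl scalerA.
rewrite !exprS; congr (_ - _); congr (_ *: _); last by ring.
by field; rewrite s_neq0 two_neq0.
Qed.

Theorem theorem2p3 (F : rcfType) (r k : nat) (e : {ffun 'I_r -> int})
    (hr : (1 <= r)%N) (hk : (1 <= k)%N) :
  #|[set w : k.-tuple (letter r) | cyclically_reduced w & word_class w == e]|%:R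
  = lcoeff e
      ((2 * Num.sqrt (2 * r%:R - 1) ^+ k)
         *: chebyshevR r k (r%:R / Num.sqrt (2 * r%:R - 1))
       + ((r%:R - 1) * (1 + (-1) ^+ k))%:A) :> F.
Proof.
set s := Num.sqrt _.
have q_gt0 : 0 < 2 * r%:R - 1 :> F.
  by rewrite subr_gt0 -natrM ltr1n (leq_trans _ (leq_mul (leqnn 2) hr)).
have s2 : s ^+ 2 = 2 * r%:R - 1 by rewrite sqr_sqrtr // ltW.
have s_neq0 : s != 0 by rewrite gt_eqF // sqrtr_gt0.
have r_neq0 : r%:R != 0 :> F by rewrite pnatr_eq0 -lt0n.
have two_neq0 : 2 != 0 :> F by rewrite pnatr_eq0.
have cardL : #|{: letter r}| = (2 * r)%N by rewrite card_prod card_ord card_bool mulnC.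
have s2A : (s ^+ 2)%:A = 2 * r%:R - 1 :> laurent F r.
  by rewrite s2 scalerBl scale1r -natrM scaler_nat natrM.
have P j := chebyshevR_rec F r j s two_neq0 r_neq0 s_neq0.
have [P0 P1 _] := P 0%N.
have trE := nbtraceE _ _ (lletter F) _ (inv_letterK r) (lletterV F r)
  (inv_letter_neq r) r (fun j => (2 * s ^+ j) *: chebyshevR r j (r%:R / s))
  cardL P0 P1 _ k.
have -> : ((r%:R - 1) * (1 + (-1) ^+ k))%:A
    = (r%:R - 1) * (1 + (-1) ^+ k) :> laurent F r.
  by rewrite -in_algE rmorphM rmorphB rmorphD rmorphXn rmorphN rmorph_nat !rmorph1.
rewrite -trE => [|j]; last by have [_ _ ->] := P j; rewrite s2A.
(* Here [hk] rules out the empty word, so the trace can be read as a sum over words. *)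
case: k hk {trE} => // k _; rewrite -cycle_sum /lcoeff raddf_sum /=.
(* Each word contributes the monomial of its class, so its coefficient at [e] is 0 or 1. *)
under eq_bigr => w _ do rewrite prod_lletter -/(lcoeff _ _) lcoeff_lmonom.
rewrite -natr_sum cardsE -sum1_card; congr _%:R.
by rewrite [LHS]big_mkcondr; apply: eq_bigr => w _; case: eqP.
Qed.
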